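(* Let $a_1/b_1$ and $a_2/b_2$ be a Farey pair with $b_1>b_2$. Let $i_{max}$ and $i$ be positive integers with $i<i_{max}$, let $N=b_1\,\mathrm{lcm}(1,2,\dots,i_{max})$, and let $q$ be an integer with $$\frac{N}{b_1(i+1)}<q\le\frac{N}{b_1i}.$$ Then: (1) If $b_1>1$, $$I_N\left(\frac{a_1q+a_2}{b_1q+b_2}\right)=I_N\left(\frac{a_1}{b_1}\right)+s\left(\frac{N}{b_1}\sum_{j=1}^{i}\frac{\varphi(j)}{j}-q\,\Phi(i)\right)+O(i^2),$$ with $s=+1$ when $a_1/b_1<a_2/b_2$ and $s=-1$ otherwise. (2) If $a_1/b_1=0/1$ and $a_2/b_2=1/0$, $$I_N\left(\frac1q\right)=2+N\sum_{j=1}^{i}\frac{\varphi(j)}{j}-q\,\Phi(i).$$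
   Context: For a positive integer $N$, the Farey sequence $F_N$ is the ascending sequence of irreducible fractions in $[0,1]$ (including $0/1$ and $1/1$) whose denominators do not exceed $N$. Fractions $a_1/b_1$, $a_2/b_2$ are written in lowest terms with nonnegative numerator and positive denominator (except for $1/0$ below). $I_N(x)$ is the position that $x$ occupies in $F_N$ (positions starting at $1$, so $I_N(0/1)=1$); equivalently $I_N(x)$ is the number of fractions of $F_N$ in $[0,x]$, and this is used as the definition for all $x \in [0,1]$. Two elements $a_1/b_1$ and $a_2/b_2$ of a Farey sequence form a Farey pair if $|a_1b_2-a_2b_1|=1$. Exceptionally, $0/1$ and $1/0$ are also allowed to form a Farey pair (with $a_1/b_1=0/1$, $a_2/b_2=1/0$); this is the only case in which $b_2=0$. $\varphi$ is Euler's totient function and $\Phi(i)=\sum_{j=1}^{i}\varphi(j)$ is the summatory totient function. The implied constant in $O(i^2)$ is absolute. *)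

(* Defs.v *)
From HB Require Import structures.
From mathcomp Require Import all_boot all_order all_algebra.

Set Implicit Arguments.
Unset Strict Implicit.
Unset Printing Implicit Defensive.

Import Order.TTheory GRing.Theory Num.Theory.
Local Open Scope ring_scope.

Definition nat_frac (a b : nat) : rat := a%:R / b%:R.

(* Restricting to coprime pairs lists every fraction once, so no [undup]. *)
Definition farey (N : nat) : seq rat :=
  sort <=%O
    [seq nat_frac p.1 p.2 |
       p <- [seq (a, b) | b <- iota 1 N, a <- iota 0 b.+1] & coprime p.1 p.2].

(* For x in [farey N] this is the 1-based position of x; it is meant for
   x in [0, 1]. *)
Definition farey_index (N : nat) (x : rat) : nat :=
  count (fun y => 0 <= y <= x) (farey N).

(* a/b is in lowest terms and is an element of F_N. *)
Definition farey_elt (N a b : nat) : bool :=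
  [&& (0 < b)%N, coprime a b & nat_frac a b \in farey N].

(* The second disjunct is the exceptional pair 0/1, 1/0. *)
Definition farey_pair (a1 b1 a2 b2 : nat) : Prop :=
  (exists N : nat,
     [/\ farey_elt N a1 b1, farey_elt N a2 b2
       & `|(a1 * b2)%:Z - (a2 * b1)%:Z| = 1])
  \/ [/\ a1 = 0%N, b1 = 1%N, a2 = 1%N & b2 = 0%N].

Definition lcm_upto (n : nat) : nat := \big[lcmn/1%N]_(1 <= j < n.+1) j.

Definition totient_sum (i : nat) : nat := (\sum_(1 <= j < i.+1) totient j)%N.

Definition totient_ratio_sum (i : nat) : rat :=
  \sum_(1 <= j < i.+1) (totient j)%:R / j%:R.

(* Main.v *)
(* A unimodular map sends a coprime pair (u, v) to (a1 u + a2 v) / (b1 u + b2 v);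
   the fractions between a1/b1 (excluded) and (a1 q + a2) / (b1 q + b2) are exactly
   the images of the pairs with v > 0 and u >= q v.  Those in F_N satisfy
   b1 u + b2 v <= N, which forces v <= i; for each v, relaxing this condition to
   u <= M := N / b1 adds at most v values of u (none when b2 = 0).
   As v divides M, the interval [q v, M[ is a union of M / v - q full residue
   systems mod v, containing (M / v - q) totient(v) integers coprime to v, and u = M
   contributes only for v = 1.  Summing over v gives the formula, with error at most
   the sum of the v <= i. *)
Require Import Defs.
From HB Require Import structures.
From mathcomp Require Import all_boot all_order all_algebra.
From mathcomp Require Import zify ring lra.

Set Implicit Arguments.
Unset Strict Implicit.
Unset Printing Implicit Defensive.

Import Order.TTheory GRing.Theory Num.Theory.
Local Open Scope ring_scope.

(** * Farey fractions as coprime pairs *)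

Definition farey_pairs (N : nat) : seq (nat * nat) :=
  [seq p <- [seq (a, b) | b <- iota 1 N, a <- iota 0 b.+1] | coprime p.1 p.2].

Lemma mem_farey_pairs N a b :
  ((a, b) \in farey_pairs N) = [&& coprime a b, (0 < b <= N)%N & (a <= b)%N].
Proof.
rewrite mem_filter; congr (_ && _).
apply/allpairsPdep/andP => [[b' [a' [Hb Ha [-> ->]]]]|[Hb Ha]].
  by move: Ha Hb; rewrite !mem_iota; lia.
by exists b, a; split => //; rewrite mem_iota; lia.
Qed.

Lemma farey_pairs_uniq N : uniq (farey_pairs N).
Proof.
apply/filter_uniq/allpairs_uniq_dep => [||[x y] [x' y'] _ _ [-> ->] //].
- exact: iota_uniq.
- by move=> b _; exact: iota_uniq.
Qed.

Lemma nat_frac_le a b c d : (0 < b)%N -> (0 < d)%N ->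
  (nat_frac a b <= nat_frac c d) = (a * d <= c * b)%N.
Proof.
move=> b0 d0; rewrite /nat_frac ler_pdivrMr ?ltr0n // mulrAC ler_pdivlMr ?ltr0n //.
by rewrite -!natrM ler_nat.
Qed.

Lemma nat_frac_lt a b c d : (0 < b)%N -> (0 < d)%N ->
  (nat_frac a b < nat_frac c d) = (a * d < c * b)%N.
Proof. by move=> b0 d0; rewrite ltNge nat_frac_le // -ltnNge. Qed.

Lemma nat_frac_inj a b c d : (0 < b)%N -> (0 < d)%N ->
  coprime a b -> coprime c d -> nat_frac a b = nat_frac c d -> (a, b) = (c, d).
Proof.
move=> b0 d0 cab ccd e.
have E : (a * d = c * b)%N.
  by apply/eqP; rewrite eqn_leq -!nat_frac_le // e lexx.
have bd : b = d.
  apply/eqP; rewrite eqn_dvd; apply/andP; split.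
    by rewrite -(Gauss_dvdr _ (n := a)) 1?coprime_sym // E dvdn_mull.
  by rewrite -(Gauss_dvdr _ (n := c)) 1?coprime_sym // -E dvdn_mull.
by move: E; rewrite bd => /eqP; rewrite eqn_pmul2r // => /eqP ->.
Qed.

Lemma farey_uniq N : uniq (farey N).
Proof.
rewrite sort_uniq map_inj_in_uniq ?farey_pairs_uniq //.
move=> [a b] [c d]; rewrite !mem_farey_pairs.
move=> /and3P[cab /andP[b0 _] _] /and3P[ccd /andP[d0 _] _] /=.
exact: nat_frac_inj.
Qed.

Lemma count_farey N P :
  count P (farey N) = count (fun p => P (nat_frac p.1 p.2)) (farey_pairs N).
Proof.
by rewrite (permP (permEl (perm_sort _ _))) count_map; apply: eq_count.
Qed.

Lemma farey_indexE N x : farey_index N x = count (<= x) (farey N).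
Proof.
rewrite /farey_index !count_farey; apply: eq_count => p /=.
by rewrite divr_ge0.
Qed.

(** * Differences of positions as counts on an interval *)

Lemma count_le_up (s : seq rat) (c x : rat) : c <= x ->
  count (<= x) s = (count (<= c) s + count (fun y => c < y <= x)%R s)%N.
Proof.
move=> cx; elim: s => //= y s ->.
case: (leP y c) => [yc|cy] /=; first by rewrite (le_trans yc cx) /=; lia.
by case: (y <= x) => /=; lia.
Qed.

(** The images of the cone fill [x, c[, whereas subtracting positions counts ]x, c]; the
    multiplicities of x and c make up the difference. *)
Lemma count_le_down (s : seq rat) (c x : rat) : x < c ->
  (count (<= c) s + count_mem x s
   = count (<= x) s + count (fun y => x <= y < c)%R s + count_mem c s)%N.
Proof.
move=> xc; elim: s => //= y s IH.
case: (ltgtP y x) => [yx|xy|->] /=.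
- by rewrite (ltW (lt_trans yx xc)) (lt_eqF (lt_trans yx xc)); lia.
- by case: ltgtP => //=; lia.
- by rewrite (ltW xc) xc (lt_eqF xc); lia.
Qed.

(** * Coprime pairs in a cone and the unimodular map *)

Definition cone_pairs (b1 b2 q i N M : nat) : seq (nat * nat) :=
  [seq p <- [seq (u, v) | v <- iota 1 i, u <- iota 0 M.+1] |
     [&& coprime p.1 p.2, q * p.2 <= p.1 & b1 * p.1 + b2 * p.2 <= N]%N].

Lemma mem_cone_pairs b1 b2 q i N M u v :
  ((u, v) \in cone_pairs b1 b2 q i N M) =
  [&& coprime u v, q * v <= u, b1 * u + b2 * v <= N, 0 < v <= i & u <= M]%N.
Proof.
rewrite mem_filter -!andbA; congr [&& _, _, _ & _].
apply/allpairsPdep/and3P => [[v' [u' [Hb Ha [-> ->]]]]|[Hb Hb' Ha]].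
  by move: Ha Hb; rewrite !mem_iota; split; lia.
by exists v, u; split => //; rewrite mem_iota; lia.
Qed.

Lemma cone_pairs_uniq b1 b2 q i N M : uniq (cone_pairs b1 b2 q i N M).
Proof.
apply/filter_uniq/allpairs_uniq_dep => [||[x y] [x' y'] _ _ [-> ->] //].
- exact: iota_uniq.
- by move=> b _; exact: iota_uniq.
Qed.

(* The inverse of the unimodular map sends (c, d) to u = c2 d - c d2 and
   v = c d1 - c1 d, written without subtraction. *)
Lemma unimodular_cone c1 d1 c2 d2 q c d : (c2 * d1 = c1 * d2 + 1)%N ->
  (coprime c d /\ (c1 * d < c * d1 /\ c * (d1 * q + d2) <= (c1 * q + c2) * d))%N
  <-> (exists u v, [/\ coprime u v, 0 < v, q * v <= u,
        c = c1 * u + c2 * v & d = d1 * u + d2 * v])%N.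
Proof.
move=> det; split=> [[co [H1 H2]]|[u [v [co v0 qv -> ->]]]].
  (* This makes u = c2 d - c d2 a natural number. In [H2], the terms with factor q are compared by
     [H1] and dropped. *)
  have H3 : (c * d2 <= c2 * d)%N.
    rewrite -(leq_add2l (q * (c * d1))).
    apply: (@leq_trans (c * (d1 * q + d2))%N); first lia.
    apply: (leq_trans H2).
    rewrite mulnDl leq_add2r; move: H1; nia.
  have [v Ev] : exists v, (c * d1 = c1 * d + v)%N.
    by exists (c * d1 - c1 * d)%N; lia.
  have [u Eu] : exists u, (c2 * d = c * d2 + u)%N.
    by exists (c2 * d - c * d2)%N; lia.
  have Ec : (c = c1 * u + c2 * v)%N by nia.
  have Ed : (d = d1 * u + d2 * v)%N by nia.
  exists u, v; split=> //; [|nia|nia].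
  move: co; rewrite /coprime -!dvdn1 => /(dvdn_trans _); apply.
  by rewrite dvdn_gcd Ec Ed !dvdn_add // dvdn_mull ?dvdn_gcdl ?dvdn_gcdr.
clear c d; set c := (c1 * u + c2 * v)%N; set d := (d1 * u + d2 * v)%N.
have Ev : (c * d1 = c1 * d + v)%N by rewrite /c /d; nia.
have Eu : (c2 * d = c * d2 + u)%N by rewrite /c /d; nia.
split; last by split; nia.
move: co; rewrite /coprime -!dvdn1 => /(dvdn_trans _); apply.
have gc := dvdn_gcdl c d; have gd := dvdn_gcdr c d.
rewrite dvdn_gcd; apply/andP; split.
  by rewrite -(dvdn_addr u (dvdn_mulr d2 gc)) -Eu dvdn_mull.
by rewrite -(dvdn_addr v (dvdn_mull c1 gd)) -Ev dvdn_mulr.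
Qed.

(** * Counting the cone row by row *)

Lemma sum_coprime_blocks v m n : (m <= n)%N ->
  (\sum_(m * v <= u < n * v) coprime u v = (n - m) * totient v)%N.
Proof.
move=> /subnKC <-; rewrite addKn; elim: (n - m)%N => [|k IH].
  by rewrite addn0 big_geq.
rewrite (big_cat_nat (n := ((m + k) * v)%N)) ?leq_mul2r ?leq_addr ?orbT //=; last first.
  by rewrite addnS leqnSn orbT.
rewrite IH mulSnr; congr addn.
(* Translating by a multiple of v preserves coprimality to v, so the last block counts like [0,
   v[. *)
have -> : ((m + k.+1) * v = v + (m + k) * v)%N by rewrite addnS mulSn.
rewrite -{1}[((m + k) * v)%N]add0n big_addn addnK totient_count_coprime.
by apply: eq_bigr => u _; rewrite -coprime_modl addnC modnMDl coprime_modl coprime_sym.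
Qed.

Definition cone_row (b1 b2 q M v : nat) : nat :=
  \sum_(0 <= u < M.+1) [&& coprime u v, q * v <= u & b1 * u + b2 * v <= b1 * M]%N.

Lemma size_cone_pairs b1 b2 q i M :
  size (cone_pairs b1 b2 q i (b1 * M) M)
  = (\sum_(1 <= v < i.+1) cone_row b1 b2 q M v)%N.
Proof.
rewrite size_filter -sum1_count big_mkcond big_allpairs_dep /=.
rewrite /index_iota subn1 /=; apply: eq_bigr => v _.
by rewrite /cone_row /index_iota subn0; apply: eq_bigr => u _ /=; case: ifP.
Qed.

Lemma sum_coprime_row q M v : (0 < v)%N -> (v %| M)%N -> (q * v <= M)%N ->
  (\sum_(0 <= u < M.+1) (coprime u v && (q * v <= u))
   = (M %/ v - q) * totient v + (v == 1))%N.
Proof.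
move=> v0 vM qv; rewrite big_nat_recr //= qv andbT; congr addn; last first.
  (* At u = M the gcd with v is v itself. *)
  by rewrite /coprime gcdnC (gcdn_idPl vM).
rewrite (big_cat_nat (n := (q * v)%N)) //= big_nat big1 ?add0n => [|u]; last first.
  by move=> /andP[_ uq]; rewrite leqNgt uq andbF.
rewrite -{1}(divnK vM) -sum_coprime_blocks ?leq_divRL // !big_nat.
by apply: eq_bigr => u /andP[-> _]; rewrite andbT.
Qed.

Lemma cone_row_le b1 b2 q M v :
  (cone_row b1 b2 q M v
   <= \sum_(0 <= u < M.+1) (coprime u v && (q * v <= u)))%N.
Proof.
apply: leq_sum => u _; case: (coprime u v) => //=.
by case: (q * v <= u)%N => //=; exact: leq_b1.
Qed.

(* Only [M - v < u <= M] can violate the last condition of [cone_row]. *)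
Lemma cone_row_ge b1 b2 q M v : (b2 < b1)%N -> (v <= M)%N ->
  (\sum_(0 <= u < M.+1) (coprime u v && (q * v <= u))
   <= cone_row b1 b2 q M v + v)%N.
Proof.
move=> b21 vM.
have Ev : (\sum_(0 <= u < M.+1) (M - v < u) = v)%N.
  rewrite (big_cat_nat (n := (M - v).+1)) //=; last by rewrite ltnS leq_subr.
  rewrite big_nat big1 ?add0n => [|u]; last first.
    by rewrite ltnS => /andP[_]; rewrite leqNgt => /negbTE ->.
  rewrite big_nat (eq_bigr (fun=> 1%N)) => [|u /andP[-> _]] //.
  by rewrite -big_nat sum_nat_const_nat muln1 subSS subKn.
rewrite -[X in (_ <= _ + X)%N]Ev -big_split /=; apply: leq_sum => u _.
case: (coprime u v) => //=; case: (q * v <= u)%N => //=.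
case: (ltnP (M - v) u) => [_|uM]; first by rewrite addn1.
(* Here u + v <= M, so b1 u + b2 v <= b1 (u + v) <= b1 M. *)
by rewrite addn0 lt0b; nia.
Qed.

Lemma cone_row0 b1 q M v : (0 < b1)%N ->
  cone_row b1 0 q M v
  = (\sum_(0 <= u < M.+1) (coprime u v && (q * v <= u)))%N.
Proof.
move=> b1_gt0; rewrite /cone_row !big_nat; apply: eq_bigr => u.
by rewrite ltnS mul0n addn0 leq_pmul2l // => /andP[_ ->]; rewrite andbT.
Qed.

(** E is the number of pairs lost by passing from u <= M to the true bound on denominators. Keeping
    it explicit lets one equation serve both the estimate and the exact formula. The final 1 is the
    pair (M, 1). *)
Lemma cone_count b1 b2 q i M : (0 < q)%N -> (0 < i)%N -> (b2 < b1)%N ->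
  (q * i <= M)%N -> (forall v, (0 < v <= i)%N -> (v %| M)%N) ->
  exists E : nat,
  [/\ (E <= i ^ 2)%N, b2 = 0%N -> E = 0%N
    & (size (cone_pairs b1 b2 q i (b1 * M) M) + E)%:R
      = M%:R * totient_ratio_sum i - q%:R * (totient_sum i)%:R + 1 :> rat].
Proof.
move=> q0 i0 b21 qiM dvM; rewrite size_cone_pairs.
set full := (fun v => \sum_(0 <= u < M.+1) (coprime u v && (q * v <= u)))%N.
have qv v : (v <= i)%N -> (q * v <= M)%N by move=> vi; nia.
have Efull : (\sum_(1 <= v < i.+1) full v)%:R
      = M%:R * totient_ratio_sum i - q%:R * (totient_sum i)%:R + 1 :> rat.
  rewrite (eq_big_nat _ _ (F2 := fun v =>
     ((M %/ v - q) * totient v + (v == 1))%N)) => [|v /andP[v0 vi]]; last first.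
    by rewrite /full sum_coprime_row ?dvM ?v0 ?qv.
  rewrite big_split natrD /=; congr (_ + _).
    rewrite natr_sum /totient_ratio_sum /totient_sum natr_sum !mulr_sumr -sumrB.
    apply: eq_big_nat => v /andP[v0 vi].
    have vM := dvM v; rewrite v0 -ltnS vi in vM; move/(_ isT): vM => vM.
    rewrite natrM natrB ?leq_divRL ?qv // mulrBl; congr (_ - _).
    rewrite -[in RHS](divnK vM) natrM; field.
    by rewrite pnatr_eq0 -lt0n.
  by rewrite big_ltn //= big_nat big1 // => v /andP[+ _]; case: v => [|[]].
exists (\sum_(1 <= v < i.+1) full v - \sum_(1 <= v < i.+1) cone_row b1 b2 q M v)%N.
have le1 : (\sum_(1 <= v < i.+1) cone_row b1 b2 q M v
            <= \sum_(1 <= v < i.+1) full v)%N.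
  by apply: leq_sum => v _; exact: cone_row_le.
rewrite subnKC //; split => //.
  rewrite leq_subLR.
  (* Row v loses at most v <= i pairs, and there are i rows. *)
  apply: (@leq_trans (\sum_(1 <= v < i.+1) (cone_row b1 b2 q M v + i))%N).
    rewrite !big_nat; apply: leq_sum => v /andP[v0 vi].
    apply: leq_trans (cone_row_ge _ b21 _) _; last by rewrite leq_add2l.
    by have := qv _ vi; nia.
  by rewrite big_split /= sum_nat_const_nat subn1 mulnn.
move=> b20; move: b21; rewrite b20 => b10; apply/eqP; rewrite subn_eq0.
by apply: leq_sum => v _; rewrite cone_row0.
Qed.

(** * Farey fractions of an interval as images of the cone *)

Definition unimodular (a1 b1 a2 b2 : nat) : Prop :=
  (a2 * b1 = a1 * b2 + 1 \/ a1 * b2 = a2 * b1 + 1)%N.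

(** The predicate P stands for either orientation of the interval. The map is injective because its
    determinant is 1 or -1, and the bound b1 M on denominators confines u and v to the finite box of
    [cone_pairs]. *)
Lemma count_cone (P : pred rat) a1 b1 a2 b2 q i M :
  unimodular a1 b1 a2 b2 -> (0 < b1)%N -> (0 < q)%N -> (M < q * i.+1)%N ->
  (a1 <= b1)%N -> (a1 * q + a2 <= b1 * q + b2)%N ->
  (forall a b, (0 < b)%N -> (coprime a b /\ P (nat_frac a b)) <->
     (exists u v, [/\ coprime u v, 0 < v, q * v <= u,
        a = a1 * u + a2 * v & b = b1 * u + b2 * v])%N) ->
  count P (farey (b1 * M)) = size (cone_pairs b1 b2 q i (b1 * M) M).
Proof.
move=> det b10 q0 Mq ab1 abq HP; rewrite count_farey -size_filter.
pose f (p : nat * nat) := (a1 * p.1 + a2 * p.2, b1 * p.1 + b2 * p.2)%N.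
rewrite -(size_map f (cone_pairs _ _ _ _ _ _)); apply/perm_size/uniq_perm.
- by rewrite filter_uniq ?farey_pairs_uniq.
- rewrite map_inj_uniq ?cone_pairs_uniq // => -[u v] [u' v'] [] /= E1 E2.
  have [E3 E4] : (u = u' /\ v = v')%N.
    set a := (a1 * u + a2 * v)%N in E1; set b := (b1 * u + b2 * v)%N in E2.
    by case: det => det; split; rewrite /a /b in E1 E2; nia.
  by rewrite E3 E4.
move=> [a b]; rewrite mem_filter mem_farey_pairs; apply/idP/mapP.
  move=> /= /and4P[Pab co /andP[b0 bN] ab].
  have /(HP _ _ b0) [u [v [cuv v0 qv Ea Eb]]] : coprime a b /\ P (nat_frac a b).
    by [].
  exists (u, v); last by rewrite /f /= Ea Eb.
  have uM : (u <= M)%N by rewrite -(leq_pmul2l b10); lia.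
  (* The bound v <= i follows from q v <= u <= M < q (i + 1). *)
  rewrite mem_cone_pairs cuv qv -Eb bN v0 uM andbT /=.
  by nia.
move=> [[u v]]; rewrite mem_cone_pairs => /and5P[cuv qv bN /andP[v0 vi] uM].
move=> [-> ->] /=.
have b0 : (0 < b1 * u + b2 * v)%N by nia.
have [|-> ->] := (HP (a1 * u + a2 * v) _ b0)%N.2; first by exists u, v.
(* The image is at most 1 because (u, v) = (u - q v) (1, 0) + v (q, 1), and the images of (1, 0) and
   (q, 1) are at most 1 by hypothesis. *)
by rewrite b0 bN /=; nia.
Qed.

Lemma count_cone_up a1 b1 a2 b2 q i M : (a2 * b1 = a1 * b2 + 1)%N ->
  (0 < b1)%N -> (0 < q)%N -> (M < q * i.+1)%N ->
  (a1 <= b1)%N -> (a1 * q + a2 <= b1 * q + b2)%N ->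
  count (fun y => nat_frac a1 b1 < y <= nat_frac (a1 * q + a2) (b1 * q + b2))
    (farey (b1 * M)) = size (cone_pairs b1 b2 q i (b1 * M) M).
Proof.
move=> det b10 q0 Mq ab1 abq; apply: (count_cone _ b10 q0 Mq ab1 abq).
  by left.
move=> a b b0; rewrite -(unimodular_cone q a b det).
rewrite nat_frac_lt // nat_frac_le //; last by nia.
by split=> -[co /andP].
Qed.

(* Exchanging numerators and denominators reverses the order of fractions, so
   [unimodular_cone] applies to the reciprocals. *)
Lemma count_cone_down a1 b1 a2 b2 q i M : (a1 * b2 = a2 * b1 + 1)%N ->
  (0 < b1)%N -> (0 < q)%N -> (M < q * i.+1)%N ->
  (a1 <= b1)%N -> (a1 * q + a2 <= b1 * q + b2)%N ->
  count (fun y => nat_frac (a1 * q + a2) (b1 * q + b2) <= y < nat_frac a1 b1)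
    (farey (b1 * M)) = size (cone_pairs b1 b2 q i (b1 * M) M).
Proof.
move=> det b10 q0 Mq ab1 abq; apply: (count_cone _ b10 q0 Mq ab1 abq).
  by right.
move=> a b b0; have det' : (b2 * a1 = b1 * a2 + 1)%N by lia.
rewrite nat_frac_lt // nat_frac_le //; last by nia.
rewrite [(a * b1)%N]mulnC [(a1 * b)%N]mulnC.
rewrite [((a1 * q + a2) * b)%N]mulnC [(a * (b1 * q + b2))%N]mulnC coprime_sym.
split=> [[co /andP[H1 H2]]|[u [v [cuv v0 qv Ea Eb]]]].
  have /(unimodular_cone q b a det') [u [v [? ? ? Eb Ea]]] := conj co (conj H2 H1).
  by exists u, v.
have [co [H1 H2]] := (unimodular_cone q b a det').2
  (ex_intro _ u (ex_intro _ v (And5 cuv v0 qv Eb Ea))).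
by split; last exact/andP.
Qed.

(** * From the hypotheses to the two formulas *)

Lemma dvdn_lcm_upto n v : (0 < v <= n)%N -> (v %| lcm_upto n)%N.
Proof.
elim: n => [|n IH]; first by lia.
rewrite /lcm_upto big_nat_recr //= => /andP[v0].
rewrite leq_eqVlt => /orP[/eqP ->|vn]; first exact: dvdn_lcmr.
by apply: dvdn_trans (dvdn_lcml _ _); apply: IH; rewrite v0.
Qed.

Lemma farey_eltP N a b :
  farey_elt N a b -> [/\ (0 < b)%N, coprime a b & (a <= b)%N].
Proof.
case/and3P=> b0 co; rewrite mem_sort => /mapP[[a' b']].
rewrite mem_farey_pairs => /and3P[co' /andP[b0' _] ab'] /= E.
by have [-> ->] := nat_frac_inj b0 b0' co co' E.
Qed.

Lemma farey_index0 N : (0 < N)%N -> count (<= nat_frac 0 1) (farey N) = 1%N.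
Proof.
move=> N0; rewrite count_farey.
rewrite (@eq_in_count _ _ (pred1 (0, 1)%N)) => [|[a b]]; last first.
  rewrite mem_farey_pairs => /and3P[co /andP[b0 _] _].
  rewrite /= nat_frac_le // muln1 mul0n leqn0 xpair_eqE.
  case: eqP co => //= ->; rewrite /coprime gcd0n => /eqP ->; exact/esym/eqxx.
by rewrite count_uniq_mem ?farey_pairs_uniq // mem_farey_pairs /= N0.
Qed.

Theorem theorem3p3 :
  exists C : rat,
  forall (a1 b1 a2 b2 imax i N : nat) (q : int),
    farey_pair a1 b1 a2 b2 ->
    (b2 < b1)%N ->
    (0 < imax)%N ->
    (0 < i)%N ->
    (i < imax)%N ->
    N = (b1 * lcm_upto imax)%N ->
    N%:R / (b1%:R * (i%:R + 1)) < (q%:~R : rat) ->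
    (q%:~R : rat) <= N%:R / (b1%:R * i%:R) ->
    ((1 < b1)%N ->
      let x : rat :=
        (a1%:R * q%:~R + a2%:R) / (b1%:R * q%:~R + b2%:R) in
      let s : rat := if nat_frac a1 b1 < nat_frac a2 b2 then 1 else - 1 in
      `| (farey_index N x)%:R
         - ((farey_index N (nat_frac a1 b1))%:R
            + s * (N%:R / b1%:R * totient_ratio_sum i
                   - q%:~R * (totient_sum i)%:R)) |
      <= C * i%:R ^+ 2)
    /\
    ([/\ a1 = 0%N, b1 = 1%N, a2 = 1%N & b2 = 0%N] ->
      (farey_index N (1 / q%:~R))%:R
      = 2 + N%:R * totient_ratio_sum i
        - q%:~R * (totient_sum i)%:R :> rat).
Proof.
(* The error is 1 - E for an increasing pair, and E - 1 plus a difference of two booleans for a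
   decreasing one, where 0 <= E <= i^2. As i >= 1, both are at most 2 i^2 in absolute value. *)
exists 2 => a1 b1 a2 b2 imax i N q pair b21 _ i0 iimax EN lbq ubq.
have b10 : (0 < b1)%N by lia.
(* Cancelling b1 turns the bounds on q into M < q (i + 1) and q i <= M; the first forces q > 0. *)
have [n Eq [n0 Mn nM]] : exists2 n : nat, q = n%:Z &
    [/\ 0 < n, lcm_upto imax < n * i.+1 & n * i <= lcm_upto imax]%N.
  have b1r : (0 : rat) < b1%:R by rewrite ltr0n.
  have ir : (0 : rat) < i%:R by rewrite ltr0n.
  move: lbq ubq; rewrite EN natrM natr1.
  rewrite -!mulf_div divff ?gt_eqF // !mul1r.
  rewrite ltr_pdivrMr ?ltr0n // ler_pdivlMr // => H1 H2.
  have : (0 : rat) < q%:~R.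
    by rewrite -(pmulr_lgt0 _ (_ : 0 < i.+1%:R)) ?ltr0n //; apply: le_lt_trans H1.
  rewrite ltr0z; case: q H1 H2 => // n H1 H2 n0; exists n => //.
  by move: H1 H2; rewrite -pmulrn -!natrM ltr_nat ler_nat.
subst q N; set M := lcm_upto imax in Mn nM *.
have dvM v : (0 < v <= i)%N -> (v %| M)%N.
  by move=> vi; apply: dvdn_lcm_upto; lia.
have [E [Ei E0 EW]] := cone_count n0 i0 b21 nM dvM.
have -> : (b1 * M)%:R / b1%:R = M%:R :> rat.
  by rewrite natrM mulrAC divff ?mul1r // pnatr_eq0 -lt0n.
rewrite -!pmulrn.
rewrite !farey_indexE; split=> [b1_gt1|[Ea1 Eb1 Ea2 Eb2]]; last first.
  subst a1 b1 a2 b2; rewrite mul1n in EW *.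
  (* The exceptional pair is an increasing case in which 1/0 is never evaluated: only 0/1 and 1/n
     occur as fractions. *)
  have := @count_cone_up 0 1 1 0 n i M erefl isT n0 Mn isT.
  rewrite !mul1n mul0n add0n addn0 => /(_ n0) EC.
  have -> : 1 / n%:R = nat_frac 1 n by [].
  rewrite (@count_le_up _ (nat_frac 0 1)); last by rewrite nat_frac_le.
  rewrite farey_index0 ?EC; last by nia.
  (* The constant 2 is 1 for the fraction 0/1 and 1 from [cone_count], where E = 0 since b2 = 0. *)
  move: EW; rewrite (E0 erefl) addn0 natrD => ->; ring.
have [b20 ab1 ab2 det] : [/\ (0 < b2)%N, (a1 <= b1)%N, (a2 <= b2)%N
    & unimodular a1 b1 a2 b2].
  case: pair => [[N [/farey_eltP[_ _ ?] /farey_eltP[? _ ?] det]]|[_ Eb1]].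
    by split=> //; move: det; rewrite /unimodular; lia.
  by rewrite Eb1 in b1_gt1.
have abq : (a1 * n + a2 <= b1 * n + b2)%N by nia.
cbv zeta.
have -> : (a1%:R * n%:R + a2%:R) / (b1%:R * n%:R + b2%:R)
    = nat_frac (a1 * n + a2) (b1 * n + b2).
  by rewrite /nat_frac !natrD !natrM.
rewrite !farey_indexE.
have bn0 : (0 < b1 * n + b2)%N by lia.
set W := size _ in EW.
have Eir : (E%:R : rat) <= i%:R ^+ 2 by rewrite -natrX ler_nat.
have i1 : (1 : rat) <= i%:R ^+ 2 by rewrite exprn_ege1 // ler1n.
have E_ge0 : (0 : rat) <= E%:R by rewrite ler0n.
rewrite natrD in EW.
case: det => det.
  rewrite nat_frac_lt // det addn1 ltnSn.
  rewrite (@count_le_up _ (nat_frac a1 b1)); last by rewrite nat_frac_le //; nia.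
  rewrite (count_cone_up det b10 n0 Mn ab1 abq) -/W natrD ler_norml.
  by apply/andP; split; lra.
rewrite nat_frac_lt // det [(_ < _)%N]ltnNge addn1 leqnSn /=.
have := @count_le_down (farey (b1 * M)) (nat_frac a1 b1)
   (nat_frac (a1 * n + a2) (b1 * n + b2)).
rewrite nat_frac_lt // => /(_ ltac:(nia)).
rewrite (count_cone_down det b10 n0 Mn ab1 abq) -/W !count_uniq_mem ?farey_uniq //.
move=> /(congr1 (fun k : nat => k%:R : rat)); rewrite !natrD => Ec.
(* The multiplicities of the two endpoints are only bounded by 0 and 1; the constant 2 absorbs
   them. *)
have mem_bound (b : bool) : 0 <= (b%:R : rat) <= 1 by rewrite ler0n lern1 leq_b1.
have /andP[? ?] := mem_bound (nat_frac a1 b1 \in farey (b1 * M)).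
have /andP[? ?] :=
  mem_bound (nat_frac (a1 * n + a2) (b1 * n + b2) \in farey (b1 * M)).
by rewrite ler_norml; apply/andP; split; lra.
Qed.
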